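(* Let $a\in\mathbb{N}$, $b\in\mathbb{Z}$ and put $g:=(a,b)$, $a':=a/g$, $b':=b/g$. Let $\tau_{a'}(\mathrm{rad}(g))=q_1\cdots q_s$ be the prime factorization of $\tau_{a'}(\mathrm{rad}(g))$. For $1\leq i\leq s$, let $k_i:=\mathrm{ord}_{a'}(q_i)$. If $\rho(a,b)=\infty$, then $s\geq 1$, $\rho_0(a,b)\geq 1$, and for $x\to\infty$ we have \[\#\{n\in R(a,b):\ n\leq x\}=\frac{\rho_0(a,b)}{s!\,\log(q_1^{k_1})\cdots\log(q_s^{k_s})}\cdot(\log x)^s+O\big((\log x)^{s-1}\big).\]
   Context: $\mathbb{N}$ is the set of positive integers, $(a,b)=\gcd(a,b)$, and $\mathrm{rad}(n)=\prod_{p\mid n}p$ (product over primes) for a nonzero integer $n$. For a prime $p$ and $k\in\mathbb{N}$, $p^k\,\|\,m$ means $p^k\mid m$ and $p^{k+1}\nmid m$; for integers $m\neq0$ and $n$, $\tau_n(m):=\prod_{p^k\| m,\ p\nmid n}p^k$. For $m\in\mathbb{N}$ and an integer $u$ coprime to $m$, $\mathrm{ord}_m(u)$ is the smallest positive integer $k$ with $u^k\equiv 1\bmod m$. For $a\in\mathbb{N}$, $b\in\mathbb{Z}$, with $g=(a,b)$, $a'=a/g$, $b'=b/g$, define \[R(a,b):=\{n\in\mathbb{N}:\ n>-b/a,\ \mathrm{rad}(a'n+b')\mid g\},\qquad \rho(a,b):=\#R(a,b)\ \text{(possibly }\infty),\] \[R_0(a,b):=\{n\in\mathbb{Z}:\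 n>-b/a,\ \text{and for every prime power } p^k\,\|\,(a'n+b') \text{ with } k\ge 1:\ p\mid g \text{ and } k<\mathrm{ord}_{a'}(p)\},\] \[\rho_0(a,b):=\#R_0(a,b).\] (Every prime dividing $a'n+b'$ is coprime to $a'$, so $\mathrm{ord}_{a'}(p)$ is defined, and $\rho_0(a,b)$ is always finite.) The implied constant in the $O$-term may depend on $a$ and $b$ but not on $x$. *)

(* Defs.v *)
From HB Require Import structures.
From mathcomp Require Import all_boot all_order all_algebra.
From mathcomp Require Import finmap.
From mathcomp Require Import all_classical all_reals all_analysis.
Import Order.TTheory GRing.Theory Num.Theory.
Import numFieldNormedType.Exports.

Set Implicit Arguments.
Unset Strict Implicit.
Unset Printing Implicit Defensive.

Local Open Scope classical_set_scope.
Local Open Scope ring_scope.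

Definition int_rad (n : int) : nat := (\prod_(p <- primes `|n|) p)%N.

Definition exactly_divides (p k : nat) (m : int) : bool :=
  ((p ^ k)%N%:Z %| m)%Z && ~~ ((p ^ k.+1)%N%:Z %| m)%Z.

(* For m != 0 and p prime, [logn p `|m|] is the unique k such that
   [exactly_divides p k m]. *)
Definition tau (n m : int) : nat :=
  (\prod_(p <- primes `|m| | ~~ (p%:Z %| n)%Z) p ^ logn p `|m|)%N.

(* Junk value 0 when no positive power of u is 1 modulo m, i.e. when u is not
   coprime to m. *)
Definition ord (m : nat) (u : int) : nat :=
  xget 0%N [set k : nat | [/\ (0 < k)%N, (u ^+ k = 1 %[mod m])%Z &
    forall j : nat, (0 < j)%N -> (u ^+ j = 1 %[mod m])%Z -> (k <= j)%N]].

Definition gab (a : nat) (b : int) : nat := gcdn a `|b|.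

Definition qa (a : nat) (b : int) : nat := (a %/ gab a b)%N.

Definition qb (a : nat) (b : int) : int := (b %/ gab a b)%Z.

Definition Rset (a : nat) (b : int) : set nat :=
  [set n : nat | [/\ (0 < n)%N, - (b%:~R / a%:R) < n%:R :> rat &
    (int_rad ((qa a b)%:Z * n%:Z + qb a b) %| gab a b)%N]].

Definition rho (R : realType) (a : nat) (b : int) : \bar R :=
  counting (Rset a b).

Definition R0set (a : nat) (b : int) : set int :=
  [set n : int | - (b%:~R / a%:R) < n%:~R :> rat /\
    forall p k : nat, prime p -> (0 < k)%N ->
      exactly_divides p k ((qa a b)%:Z * n + qb a b) ->
      (p %| gab a b)%N /\ (k < ord (qa a b) p)%N].

(* [R0set a b] is finite for 0 < a, so this is its cardinality. *)
Definition rho0 (a : nat) (b : int) : nat := #|` fset_set (R0set a b)|.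

(* The set is bounded by x, hence finite. *)
Definition Rcount (R : realType) (a : nat) (b : int) (x : R) : nat :=
  #|` fset_set [set n : nat | Rset a b n /\ n%:R <= x]|.

(* Main.v *)
Require Import Defs.
From HB Require Import structures.
From mathcomp Require Import all_boot all_order all_algebra.
From mathcomp Require Import finmap cyclic.
From mathcomp Require Import all_classical all_reals all_analysis.
From mathcomp Require Import zify ring lra.
Import Order.TTheory GRing.Theory Num.Theory.
Import numFieldNormedType.Exports.

(** Write d = a/g and r = b/g, and put m = d n + r. The primes dividing g but
    not d are q_1, ..., q_s, and since m is coprime to d, the condition on n is
    that m be positive with all its primes among the q_i ([RsetE]). So the
    problem is to count the numbers m <= d x + r with all primes among the q_i
    in one residue class modulo d; passing from n to m costs a bounded error,
    coming from the m <= |r| with n <= 0 ([count_progression_bounds]).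

    Divide the exponent of each q_i in m by k_i = ord_d(q_i): this factors m
    uniquely as m0 m1, where the exponents of m0 are less than the k_i and
    those of m1 are multiples of the k_i. As q_i^k_i = 1 mod d, also
    m1 = 1 mod d, so m is in the class of r exactly when m0 is, and the m0 that
    occur are exactly the values of d n + r for n in R_0(a,b), with negative n
    allowed ([R0setE], [rho0E]). Hence the count is the sum over these rho_0
    numbers m0 of the number of m1 <= (d x + r) / m0 ([count_smooth_class]).

    The numbers m1 are the products of powers of the q_i^k_i, so with
    w_i = ln (q_i^k_i) those with m1 <= z correspond to lattice points
    l in N^s with sum_i l_i w_i <= ln z. There are as many as the volume
    (ln z)^s / (s! w_1 ... w_s) of the simplex predicts, up to
    O((ln z)^(s-1)). Both bounds are obtained without integration, from the
    recursion that splits off the points with l_1 = 0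
    ([count_multiple_exponents_cons]) and the tangent inequalities for the
    function T^(s+1) ([count_multiple_exponents_ge],
    [count_multiple_exponents_le]). Replacing z = (d x + r) / m0 by x moves
    the logarithm by O(1) only ([progression_quotient_log]), and summing over
    m0 gives the main term. *)

Set Implicit Arguments.
Unset Strict Implicit.
Unset Printing Implicit Defensive.

Local Open Scope classical_set_scope.
Local Open Scope nat_scope.

(** * Smooth numbers with exponents split by Euclidean division *)

Definition smooth (qs : seq nat) (m : nat) : bool :=
  (0 < m) && all (mem qs) (primes m).

Definition multiple_exponents (qs : seq nat) (e : nat -> nat) (m : nat) :
    bool :=
  smooth qs m && all (fun q => e q %| logn q m) qs.

Definition small_exponents (qs : seq nat) (e : nat -> nat) (m : nat) : bool :=
  smooth qs m && all (fun q => logn q m < e q) qs.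

Definition from_exponents (qs : seq nat) (f : nat -> nat) : nat :=
  \prod_(q <- qs) q ^ f q.

Definition count_multiple_exponents (qs : seq nat) (e : nat -> nat)
    (z : nat) : nat :=
  count (multiple_exponents qs e) (iota 1 z).

Definition small_exponents_class (qs : seq nat) (e : nat -> nat)
    (c : pred nat) : seq nat :=
  [seq m <- iota 1 (from_exponents qs e) | small_exponents qs e m && c m].

Lemma smoothP qs m :
  reflect (0 < m /\ forall p, prime p -> p %| m -> p \in qs) (smooth qs m).
Proof.
apply: (iffP andP) => -[m0 H]; split=> //.
  by move=> p pp pm; apply: (allP H); rewrite mem_primes pp m0.
by apply/allP => p; rewrite mem_primes => /and3P[pp _ pm]; exact: H.
Qed.

Lemma smooth_gt0 qs m : smooth qs m -> 0 < m.
Proof. by case/andP. Qed.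

Lemma smoothM qs m n : smooth qs (m * n) = smooth qs m && smooth qs n.
Proof.
rewrite /smooth muln_gt0; case: posnP => //= m0; case: posnP => //= n0.
  by rewrite andbF.
rewrite (eq_all_r (s2 := primes m ++ primes n)) ?all_cat // => p.
by rewrite primesM // mem_cat.
Qed.

Lemma logn_notin qs m p : smooth qs m -> p \notin qs -> logn p m = 0.
Proof.
move=> /smoothP[m0 H] pqs; apply/eqP; rewrite -leqn0 leqNgt logn_gt0.
by rewrite mem_primes; apply: contra pqs => /and3P[pp _]; exact: H.
Qed.

Lemma smooth_eq qs m n : smooth qs m -> smooth qs n ->
  {in qs, forall q, logn q m = logn q n} -> m = n.
Proof.
move=> sm sn H; apply: eqn_from_log;
  rewrite ?(smooth_gt0 sm) ?(smooth_gt0 sn)//.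
move=> p; have [/H//|pqs] := boolP (p \in qs).
by rewrite !(logn_notin (qs := qs)).
Qed.

Lemma logn_from_exponents qs f p : all prime qs -> uniq qs ->
  logn p (from_exponents qs f) = if p \in qs then f p else 0.
Proof.
rewrite /from_exponents; elim: qs => [|q qs IH] /=.
  by move=> _ _; rewrite big_nil logn1.
move=> /andP[pq pqs] /andP[qnin uqs]; rewrite big_cons lognM; last first.
- by rewrite big_seq prodn_cond_gt0 // => i /(allP pqs)/prime_gt0;
    rewrite expn_gt0 => ->.
- by rewrite expn_gt0 prime_gt0.
rewrite IH // lognX logn_prime // inE; move: qnin;
  case: eqVneq => [->|_] qnin /=.
  by rewrite (negbTE qnin) addn0 muln1.
by rewrite muln0.
Qed.

Lemma from_exponents_smooth qs f : all prime qs ->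
  smooth qs (from_exponents qs f).
Proof.
rewrite /from_exponents => pqs; rewrite big_seq; elim/big_ind: _ => //.
  by move=> x y sx sy; rewrite smoothM sx.
move=> q qqs; have pq := allP pqs _ qqs; apply/smoothP; split.
  by rewrite expn_gt0 prime_gt0.
by move=> p pp; rewrite Euclid_dvdX // => /andP[+ _];
  rewrite dvdn_prime2 // => /eqP->.
Qed.

Lemma from_exponentsE qs f m : all prime qs -> uniq qs -> smooth qs m ->
  {in qs, forall q, logn q m = f q} -> m = from_exponents qs f.
Proof.
move=> pqs uqs sm H; apply: (smooth_eq sm); first exact: from_exponents_smooth.
by move=> q qqs; rewrite logn_from_exponents // qqs H.
Qed.

Lemma small_exponents_le qs e m : all prime qs -> uniq qs ->
  small_exponents qs e m -> m <= from_exponents qs e.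
Proof.
move=> pqs uqs /andP[sm /allP rm].
rewrite (from_exponentsE (f := logn^~ m) pqs uqs sm) //.
rewrite /from_exponents !big_seq; apply: leq_prod => q qqs.
by rewrite leq_exp2l ?prime_gt1 ?(allP pqs) // ltnW ?rm.
Qed.

Lemma mem_small_exponents_class qs e c m : all prime qs -> uniq qs ->
  (m \in small_exponents_class qs e c) = small_exponents qs e m && c m.
Proof.
move=> pqs uqs; rewrite mem_filter mem_iota add1n ltnS.
case: (boolP (small_exponents _ _ _)) => //= rm.
by rewrite small_exponents_le // (smooth_gt0 (qs := qs)) ?andbT //;
  case/andP: rm.
Qed.

(** The Euclidean division of each exponent [logn q m] by [e q]: the remainders
    give m0, the multiples of [e q] give m1. *)
Lemma smooth_decomposition qs e m : all prime qs -> uniq qs ->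
    {in qs, forall q, 0 < e q} -> smooth qs m ->
  exists m0 m1, [/\ m = m0 * m1, small_exponents qs e m0 &
    multiple_exponents qs e m1].
Proof.
move=> pqs uqs e0 sm.
exists (from_exponents qs (fun q => logn q m %% e q)).
exists (from_exponents qs (fun q => logn q m %/ e q * e q)).
split.
- apply: (smooth_eq sm); first by rewrite smoothM !from_exponents_smooth.
  move=> q qqs; rewrite lognM ?(smooth_gt0 (from_exponents_smooth _ _)) //.
  by rewrite !logn_from_exponents // qqs addnC -divn_eq.
- rewrite /small_exponents from_exponents_smooth //=; apply/allP => q qqs /=.
  by rewrite logn_from_exponents // qqs ltn_mod e0.
- rewrite /multiple_exponents from_exponents_smooth //=; apply/allP => q qqs /=.
  by rewrite logn_from_exponents // qqs dvdn_mull.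
Qed.

(** Modulo [e q] the exponent of q in m0 * m1 is that of m0, and an exponent
    below [e q] is determined by its class modulo [e q]. *)
Lemma small_part_uniq qs e m0 m1 n0 n1 :
    small_exponents qs e m0 -> multiple_exponents qs e m1 ->
    small_exponents qs e n0 -> multiple_exponents qs e n1 ->
  m0 * m1 = n0 * n1 -> m0 = n0.
Proof.
have modE a0 a1 q :
    small_exponents qs e a0 -> multiple_exponents qs e a1 -> q \in qs ->
    logn q (a0 * a1) %% e q = logn q a0.
  move=> /andP[sa0 /allP ra0] /andP[sa1 /allP fa1] qqs.
  rewrite lognM ?(smooth_gt0 sa0) ?(smooth_gt0 sa1) //.
  by rewrite -modnDmr (eqP (fa1 _ qqs)) addn0 modn_small // ra0.
move=> rm fm rn fn E; apply: (smooth_eq (qs := qs));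
  do ?by [case/andP: rm|case/andP: rn].
by move=> q qqs; rewrite -(modE m0 m1) // E modE.
Qed.

Lemma count_dvd (P : pred nat) d y : 0 < d ->
  count (fun m => (d %| m) && P (m %/ d)) (iota 1 y) =
  count P (iota 1 (y %/ d)).
Proof.
move=> d0; rewrite -!size_filter -[RHS](size_map (muln d)); apply/perm_size.
apply: uniq_perm; rewrite ?filter_uniq ?iota_uniq // ?map_inj_uniq
  ?filter_uniq ?iota_uniq//.
  by move=> u v /eqP; rewrite eqn_pmul2l // => /eqP.
move=> m; rewrite mem_filter mem_iota add1n ltnS; apply/andP/mapP.
  move=> [/andP[/dvdnP[u ->]]]; rewrite mulnK // => Pu /andP[m0 my].
  exists u; last by rewrite mulnC.
  by rewrite mem_filter Pu mem_iota add1n ltnS leq_divRL // my andbT;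
    case: u m0 {Pu my}.
move=> [u]; rewrite mem_filter mem_iota add1n ltnS leq_divRL //.
move=> /and3P[Pu u0 uy] ->; rewrite mulKn // dvdn_mulr // Pu; split=> //.
by rewrite muln_gt0 d0 u0 mulnC.
Qed.

(** If c is insensitive to the factor m1, the smooth m satisfying c correspond
    to the pairs (m0, m1) with c m0; for fixed m0, the bound m <= y becomes
    m1 <= y %/ m0. *)
Lemma count_smooth_class qs e c y : all prime qs -> uniq qs ->
    {in qs, forall q, 0 < e q} ->
    (forall m0 m1, multiple_exponents qs e m1 -> c (m0 * m1) = c m0) ->
  count (fun m => smooth qs m && c m) (iota 1 y) =
  \sum_(m0 <- small_exponents_class qs e c)
    count_multiple_exponents qs e (y %/ m0).
Proof.
move=> pqs uqs e0 cM; set M0 := small_exponents_class _ _ _.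
have M0E m : (m \in M0) = small_exponents qs e m && c m.
  exact: mem_small_exponents_class.
have M0gt0 m : m \in M0 -> 0 < m.
  by rewrite M0E => /andP[/andP[/smooth_gt0]].
transitivity (\sum_(m0 <- M0)
    count (fun m => (m0 %| m) && multiple_exponents qs e (m %/ m0))
      (iota 1 y)); last first.
  by apply: eq_big_seq => m0 m0M; rewrite count_dvd ?M0gt0.
rewrite -sum1_count big_mkcond /=.
under [in RHS]eq_bigr do rewrite -sum1_count big_mkcond.
rewrite exchange_big /=; apply: eq_bigr => m _.
rewrite -big_mkcond sum1_count; case: ifPn => [/andP[sm cm]|nsc].
  (* The pair (m0, m1) of m is the only one, so exactly one m0 contributes. *)
  have [m0 [m1 [mE rm0 fm1]]] := smooth_decomposition pqs uqs e0 sm.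
  have m0M : m0 \in M0 by rewrite M0E rm0 -(cM _ m1) // -mE.
  have uM0 : uniq M0 by rewrite filter_uniq ?iota_uniq.
  rewrite -[LHS](_ : count_mem m0 M0 = 1); last by rewrite count_uniq_mem ?m0M.
  apply: eq_in_count => n0; rewrite M0E => /andP[rn0 _] /=.
  apply/eqP/andP => [->|[/dvdnP[n1 mE']]].
    by rewrite mE dvdn_mulr // mulKn ?M0gt0.
  rewrite mE' mulnK; last by case/andP: rn0 => /smooth_gt0.
  by move=> fn1; apply: (small_part_uniq (e := e) rn0 fn1 rm0 fm1);
    rewrite -mE mulnC.
symmetry; apply/eqP; rewrite -leqn0 leqNgt -has_count; apply: contra nsc.
move=> /hasP[m0]; rewrite M0E => /andP[/andP[sm0 _] cm0] /andP[/dvdnP[m1 ->]].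
by rewrite mulnK ?(smooth_gt0 sm0) // => fm1;
  rewrite mulnC smoothM sm0 cM // cm0; case/andP: fm1 => ->.
Qed.

Lemma count_multiple_exponents_nil e z : 0 < z ->
  count_multiple_exponents [::] e z = 1.
Proof.
case: z => // z _; rewrite /count_multiple_exponents /= -[RHS]addn0; congr addn.
apply/eqP; rewrite -leqn0 leqNgt -has_count; apply/hasPn => m.
rewrite mem_iota => /andP[m1 _]; rewrite /multiple_exponents /= andbT;
  apply/negP => /smoothP[_ H].
by have := H _ (pdiv_prime m1) (pdiv_dvd m).
Qed.

(** A number counted on the left is either prime to q, or divisible by
    [q ^ e q] with a quotient of the same kind. In logarithmic coordinates
    this separates the lattice points of the simplex on the face l_1 = 0 from
    the others, which a shift by one brings back to a smaller simplex. *)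
Lemma count_multiple_exponents_cons q qs e z : prime q -> q \notin qs ->
  0 < e q ->
  count_multiple_exponents (q :: qs) e z =
  count_multiple_exponents qs e z +
  count_multiple_exponents (q :: qs) e (z %/ q ^ e q).
Proof.
move=> pq qnin e0; have q0 := prime_gt0 pq.
have P0 : 0 < q ^ e q by rewrite expn_gt0 q0.
rewrite /count_multiple_exponents -(count_dvd _ _ P0) -count_predUI.
rewrite [X in _ + X](_ : _ = 0) ?addn0; last first.
  apply/eqP; rewrite -leqn0 leqNgt -has_count; apply/hasPn => m _ /=.
  apply/negP => /and3P[/andP[/smoothP[m0 sm] _] Pm _].
  by move/negP: qnin; apply; apply: sm => //; apply: dvdn_trans Pm;
    exact: dvdn_exp.
apply: eq_in_count => m; rewrite mem_iota /multiple_exponents /= => /andP[m0 _].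
have [qm|qm] := boolP (q %| m); last first.
  rewrite [X in _ || X](_ : _ = false) ?orbF; last first.
    by apply/negbTE/negP => /andP[Pm _]; move/negP: qm; apply;
      apply: dvdn_trans Pm; exact: dvdn_exp.
  have -> : logn q m = 0.
    by apply/eqP; rewrite -leqn0 leqNgt logn_gt0 mem_primes pq m0.
  rewrite dvdn0 /=; congr andb; apply/smoothP/smoothP => -[_ H];
    split=> // p pp pm.
    by move: (H p pp pm); rewrite inE; case: eqVneq => // pE;
      rewrite -pE pm in qm.
  by rewrite inE (H p pp pm) orbT.
rewrite [X in X || _](_ : _ = false) /=; last first.
  by apply/negbTE/negP => /andP[/smoothP[_ H] _]; move/negP: qnin; apply;
    exact: H.
have [Pm|Pm] /= := boolP (q ^ e q %| m); last first.
  apply/negbTE/negP => /and3P[_ el _]; move/negP: Pm; apply.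
  by rewrite pfactor_dvdn // dvdn_leq // logn_gt0 mem_primes pq m0.
case/dvdnP: Pm m0 {qm} => u ->; rewrite mulnK // => m0.
have u0 : 0 < u by case: u m0.
rewrite smoothM (_ : smooth _ (q ^ _)) ?andbT; last first.
  apply/smoothP; split=> // p pp; rewrite Euclid_dvdX // => /andP[+ _].
  by rewrite dvdn_prime2 // inE => ->.
rewrite lognM // pfactorK // dvdn_addl //; congr [&& _, _ & _].
apply: eq_in_all => p pqs;
  rewrite lognM // lognX (_ : logn p q = 0) ?muln0 ?addn0 //.
by rewrite logn_prime //; case: eqVneq => // E; move: qnin; rewrite -E pqs.
Qed.

(** * Radicals and multiplicative orders *)

Lemma prod_primes_gt0 (l : seq nat) : all prime l -> 0 < \prod_(q <- l) q.
Proof.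
elim: l => [|q l IH]; first by rewrite big_nil.
by move=> /andP[pq pl]; rewrite big_cons muln_gt0 prime_gt0 // IH.
Qed.

Lemma logn_prod_primes p (l : seq nat) : all prime l ->
  logn p (\prod_(q <- l) q) = count_mem p l.
Proof.
elim: l => [|q l IH]; first by rewrite big_nil logn1.
move=> /andP[pq pl]; rewrite big_cons lognM ?prod_primes_gt0 ?prime_gt0 //.
by rewrite IH // logn_prime //= eq_sym.
Qed.

(** Unique factorization: the multiplicity of p in the list is the p-adic
    valuation of the product. *)
Lemma perm_eq_primes (l1 l2 : seq nat) : all prime l1 -> all prime l2 ->
  \prod_(p <- l1) p = \prod_(p <- l2) p -> perm_eq l1 l2.
Proof.
move=> p1 p2 E; apply/allP => p _ /=.
by rewrite -!logn_prod_primes // E.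
Qed.

Lemma primes_int_rad (n : int) : primes (int_rad n) = primes `|n|.
Proof.
have ap : all prime (primes `|n|) by exact: all_prime_primes.
apply: (irr_sorted_eq ltn_trans ltnn (sorted_primes _) (sorted_primes _)) => p.
have r0 : 0 < int_rad n by exact: prod_primes_gt0.
rewrite -!logn_gt0 /int_rad logn_prod_primes // count_uniq_mem ?primes_uniq //.
by rewrite lt0b logn_gt0.
Qed.

Lemma logn_int_rad p (n : int) : logn p (int_rad n) = (p \in primes `|n|).
Proof.
by rewrite /int_rad logn_prod_primes ?all_prime_primes // count_uniq_mem
  ?primes_uniq.
Qed.

(** The primes q_1, ..., q_s of the statement for d = a/g. *)
Definition residual_primes (d g : nat) : seq nat :=
  [seq p <- primes g | ~~ (p %| d)].

Lemma residual_primes_prime d g : all prime (residual_primes d g).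
Proof. by apply/allP => p; rewrite mem_filter mem_primes => /and4P[]. Qed.

Lemma residual_primes_uniq d g : uniq (residual_primes d g).
Proof. by rewrite filter_uniq // primes_uniq. Qed.

Lemma tau_int_rad (d g : nat) :
  tau d (int_rad g) = \prod_(p <- residual_primes d g) p.
Proof.
rewrite /tau absz_nat primes_int_rad absz_nat big_filter big_seq_cond.
rewrite [RHS]big_seq_cond; apply: eq_bigr => p /andP[pg _].
by rewrite logn_int_rad absz_nat pg expn1.
Qed.

Lemma int_rad_dvd (n : int) g : n != 0%R -> 0 < g ->
  (int_rad n %| g) = all (mem (primes g)) (primes `|n|).
Proof.
move=> n0 g0; rewrite -absz_gt0 in n0; apply/idP/allP => [H p|H].
  rewrite -primes_int_rad /= !mem_primes g0 => /and3P[-> _ pn] /=.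
  exact: dvdn_trans pn H.
have r0 : 0 < int_rad n by exact/prod_primes_gt0/all_prime_primes.
apply/dvdn_partP => // p;
  rewrite /= -[p \in \pi(_)]/(p \in primes _) primes_int_rad => pn.
rewrite p_part logn_int_rad pn expn1.
by have := H _ pn; rewrite /= mem_primes => /and3P[].
Qed.

Lemma eqz_pow1_nat (q j d : nat) :
  (((q : int) ^+ j)%R = 1 %[mod d])%Z <-> q ^ j = 1 %[mod d].
Proof.
have -> : ((q : int) ^+ j)%R = (q ^ j)%N by rewrite -[RHS]natz natrX natz.
by rewrite -[1%R]/(Posz 1) !modz_nat; split=> [[]|->].
Qed.

(** Euler's theorem provides a positive exponent, so [ord] does not take its
    default value. *)
Lemma ord_spec (d q : nat) : 0 < d -> coprime q d ->
  0 < ord d q /\ q ^ ord d q = 1 %[mod d].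
Proof.
move=> d0 cqd; rewrite /ord; set A := (X in xget _ X).
have [k Ak] : exists k, A k.
  pose P k := (0 < k) && (q ^ k == 1 %[mod d]).
  have exP : exists k, P k.
    by exists (totient d); rewrite /P totient_gt0 d0 Euler_exp_totient //=.
  case: (ex_minnP exP) => k /andP[k0 /eqP kE] kmin; exists k; split=> //;
    first exact/eqz_pow1_nat.
  by move=> j j0 /eqz_pow1_nat /eqP jE; apply: kmin; rewrite /P j0.
by have [k0 /eqz_pow1_nat] := xgetPex 0 (ex_intro _ _ Ak).
Qed.

Lemma multiple_exponents_mod1 d qs e m :
    {in qs, forall q, q ^ e q = 1 %[mod d]} ->
    all prime qs -> uniq qs -> multiple_exponents qs e m -> m = 1 %[mod d].
Proof.
move=> E pqs uqs /andP[sm /allP fm].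
rewrite (from_exponentsE (f := logn^~ m) pqs uqs sm) // /from_exponents big_seq.
elim/big_ind: _ => // [x y xE yE|q qqs]; first by rewrite -modnMm xE yE modnMm.
have /dvdnP[t ->] := fm _ qqs.
by rewrite mulnC expnM -modnXm E // modnXm exp1n.
Qed.

(** * The arithmetic progression attached to a and b *)

Definition progression (d : nat) (r n : int) : int := (d%:Z * n + r)%R.

Lemma gab_gt0 a b : 0 < a -> 0 < gab a b.
Proof. by move=> a0; rewrite /gab gcdn_gt0 a0. Qed.

Lemma qa_mul_gab a b : qa a b * gab a b = a.
Proof. by rewrite divnK // dvdn_gcdl. Qed.

Lemma qb_mul_gab a b : (qb a b * gab a b)%R = b.
Proof. by rewrite /qb divzK // dvdzE /= dvdn_gcdr. Qed.

Lemma qa_gt0 a b : 0 < a -> 0 < qa a b.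
Proof. by move=> a0; rewrite divn_gt0 ?gab_gt0 // dvdn_leq // dvdn_gcdl. Qed.

Lemma coprime_qa_qb a b : 0 < a -> coprime (qa a b) `|qb a b|.
Proof.
move=> a0; have g0 := gab_gt0 b a0.
rewrite /coprime -(eqn_pmul2r g0) mul1n muln_gcdl qa_mul_gab.
by rewrite -{1}[gab a b]absz_nat -abszM qb_mul_gab.
Qed.

Lemma ltr_ratio_progression a b (n : int) : 0 < a ->
  ((- (b%:~R / a%:R) < n%:~R :> rat) = (0 < progression (qa a b) (qb a b) n))%R.
Proof.
move=> a0; have g0 := gab_gt0 b a0.
have g0' : (0 < (gab a b)%:Z)%R by [].
rewrite -(pmulr_lgt0 _ g0') /progression mulrDl qb_mul_gab mulrAC -PoszM
  qa_mul_gab.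
have a0' : (0 < a%:R :> rat)%R by rewrite ltr0n.
rewrite -mulNr ltr_pdivrMr // (_ : (a%:R = (a : int)%:~R)%R) // -intrM -intrN
  ltr_int.
by rewrite -[RHS]subr_gt0 subr0 -[LHS]subr_gt0 opprK mulrC.
Qed.

(** A common prime of d and d n + r would divide r as well. *)
Lemma progression_coprime d r n p : coprime d `|r| -> prime p ->
  p %| `|progression d r n| -> ~~ (p %| d).
Proof.
move=> cdr pp pm; apply/negP => pd.
have : p %| gcdn d `|r|.
  rewrite dvdn_gcd pd /=; move: pm; rewrite -!(@dvdzE p) /progression.
  by rewrite rpredDl // dvdz_mulr // dvdzE.
by rewrite (eqP cdr) dvdn1 => /eqP p1; rewrite p1 in pp.
Qed.

(** [ord] reads its second argument as an integer; as a function on [nat] it is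
    the exponent function e to which the results on smooth numbers apply. *)
Definition order_at (d q : nat) : nat := ord d q.

Lemma order_at_gt0 d g : 0 < d ->
  {in residual_primes d g, forall q, 0 < order_at d q}.
Proof.
move=> d0 q; rewrite mem_filter mem_primes => /and3P[qd pq _].
by have [] := @ord_spec d q d0; rewrite // prime_coprime.
Qed.

Lemma expn_order_at d g : 0 < d ->
  {in residual_primes d g, forall q, q ^ order_at d q = 1 %[mod d]}.
Proof.
move=> d0 q; rewrite mem_filter mem_primes => /and3P[qd pq _].
by have [] := @ord_spec d q d0; rewrite // prime_coprime.
Qed.

(** A prime dividing d n + r does not divide d, so for d n + r the condition on
    the radical only concerns the primes of g that do not divide d. *)
Lemma RsetE a b n : 0 < a ->
  Rset a b n <-> [&& 0 < n, (0 < progression (qa a b) (qb a b) n)%R &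
    smooth (residual_primes (qa a b) (gab a b))
      `|progression (qa a b) (qb a b) n|].
Proof.
move=> a0; have g0 := gab_gt0 b a0; have cab := coprime_qa_qb b a0.
rewrite /Rset /= (_ : (n%:R = (n : int)%:~R)%R) // ltr_ratio_progression //.
rewrite -[(_ * _ + _)%R]/(progression (qa a b) (qb a b) n);
  set m := progression _ _ _.
split=> [[n0 m0]|/and3P[n0 m0 /smoothP[_ H]]].
  rewrite int_rad_dvd ?gt_eqF // => /allP H; rewrite n0 m0; apply/smoothP.
  split=> [|p pp pm]; first by rewrite absz_gt0 gt_eqF.
  rewrite mem_filter (progression_coprime cab pp pm) /=.
  by apply: H; rewrite mem_primes pp pm absz_gt0 gt_eqF.
split=> //; rewrite int_rad_dvd ?gt_eqF //; apply/allP => p.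
by rewrite mem_primes => /and3P[pp _ /(H _ pp)]; rewrite mem_filter => /andP[].
Qed.

Lemma exactly_dividesE p k (m : int) : prime p -> m != 0%R ->
  exactly_divides p k m = (logn p `|m| == k).
Proof.
move=> pp m0; rewrite -absz_gt0 in m0.
by rewrite /exactly_divides !dvdzE !absz_nat !pfactor_dvdn // -ltnNge ltnS
  eqn_leq andbC.
Qed.

(** The condition k < ord at the exact exponent k of each prime divisor of
    d n + r bounds the exponents, and for a residual prime that does not
    divide d n + r the bound holds because orders are positive. *)
Lemma R0setE a b n : 0 < a ->
  R0set a b n <-> (0 < progression (qa a b) (qb a b) n)%R &&
    small_exponents (residual_primes (qa a b) (gab a b)) (order_at (qa a b))
      `|progression (qa a b) (qb a b) n|.
Proof.
move=> a0; have g0 := gab_gt0 b a0; have cab := coprime_qa_qb b a0.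
have d0 := qa_gt0 b a0.
rewrite /R0set /= ltr_ratio_progression //.
rewrite -[(_ * _ + _)%R]/(progression (qa a b) (qb a b) n);
  set m := progression _ _ _.
split=> [[m0 H]|/and3P[m0 /smoothP[_ sm] /allP rm]].
  have m0' : 0 < `|m| by rewrite absz_gt0 gt_eqF.
  have {}H p : prime p -> 0 < logn p `|m| ->
    p %| gab a b /\ logn p `|m| < ord (qa a b) p.
    move=> pp k0; apply: (H p _ pp k0).
    by rewrite -/m exactly_dividesE // gt_eqF.
  apply/and3P; split=> //.
    apply/smoothP; split=> // p pp pm; have [|pg _] := H p pp.
      by rewrite logn_gt0 mem_primes pp m0' pm.
    by rewrite mem_filter (progression_coprime cab pp pm) mem_primes pp g0 pg.
  apply/allP => q qqs /=; case: (posnP (logn q `|m|)) => [->|k0].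
    exact: (order_at_gt0 d0 qqs).
  by apply: (H q _ k0).2; exact: (allP (residual_primes_prime _ _) _ qqs).
split=> // p k pp k0; rewrite exactly_dividesE ?(gt_eqF m0) // => /eqP kE.
have pqs : p \in residual_primes (qa a b) (gab a b).
  by apply: sm => //; move: k0; rewrite -kE logn_gt0 mem_primes => /and3P[].
split; last by rewrite -kE; exact: rm.
by move: pqs; rewrite mem_filter mem_primes => /and4P[].
Qed.

(** * From indices n to smooth numbers in a residue class *)

Lemma card_fset_set_seq (T : choiceType) (A : set T) (s : seq T) : uniq s ->
  (forall x, A x <-> x \in s) -> #|` fset_set A| = size s.
Proof.
move=> us As; have -> : A = [set` [fset x in s]%fset].
  by apply/seteqP; split => x /=; rewrite ?inE => /As //.
by rewrite set_fsetK card_fseq undup_id.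
Qed.

Definition residue_class (d : nat) (r : int) (m : nat) : bool :=
  (Posz m == r %[mod d])%Z.

Lemma residue_classP d r m :
  reflect (exists t : int, Posz m = progression d r t) (residue_class d r m).
Proof.
rewrite /residue_class eqz_mod_dvd /progression.
apply: (iffP dvdzP) => -[t tE]; exists t; move: tE.
  by move/eqP; rewrite subr_eq mulrC => /eqP.
by move=> ->; rewrite addrK mulrC.
Qed.

Lemma residue_classM d r m0 m1 : m1 = 1 %[mod d] ->
  residue_class d r (m0 * m1) = residue_class d r m0.
Proof.
move=> E; rewrite /residue_class modz_nat -modnMmr E modnMmr muln1.
by rewrite modz_nat.
Qed.

Lemma progression_inj d r : 0 < d -> injective (progression d r).
Proof.
move=> d0 t u; rewrite /progression => /addIr; apply: mulfI.
by rewrite -lt0n.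
Qed.

Lemma rho0E a b : 0 < a ->
  rho0 a b = size (small_exponents_class (residual_primes (qa a b) (gab a b))
    (order_at (qa a b)) (residue_class (qa a b) (qb a b))).
Proof.
move=> a0; have d0 := qa_gt0 b a0.
set d := qa a b in d0 *; set r := qb a b; set M0 := small_exponents_class _ _ _.
have M0E m : (m \in M0) =
    small_exponents (residual_primes d (gab a b)) (order_at d) m &&
    residue_class d r m.
  by rewrite mem_small_exponents_class ?residual_primes_prime
    ?residual_primes_uniq.
have dn0 : (Posz d != 0)%R by rewrite -lt0n.
have progK t : ((progression d r t - r) %/ d)%Z = t.
  by rewrite /progression addrK mulrC mulzK.
rewrite -(size_map (fun m : nat => ((Posz m - r) %/ d)%Z));
  apply: card_fset_set_seq.
  rewrite map_inj_in_uniq ?filter_uniq ?iota_uniq // => m1 m2.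
  rewrite !M0E => /andP[_ /residue_classP[t1 E1]] /andP[_].
  move=> /residue_classP[t2 E2].
  by rewrite E1 E2 !progK => t12; apply/eqP; rewrite -eqz_nat E1 E2 t12.
move=> n; split=> [/(R0setE _ _ a0)/andP[m0 rm]|/mapP[m]].
  apply/mapP; exists `|progression d r n|; last by rewrite gtz0_abs // progK.
  by rewrite M0E rm; apply/residue_classP; exists n; rewrite gtz0_abs.
rewrite M0E => /andP[rm /residue_classP[t mE]]; rewrite mE progK => ->.
apply/(R0setE _ _ a0); rewrite -/d -/r -mE absz_nat rm andbT.
by case/andP: rm => /smooth_gt0.
Qed.

Lemma RcountE (R : realType) a b (x : R) : 0 < a -> (0 <= x)%R ->
  Rcount a b x =
  count (fun n : nat => (0 < progression (qa a b) (qb a b) n)%R &&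
      smooth (residual_primes (qa a b) (gab a b))
        `|progression (qa a b) (qb a b) n|)
    (iota 1 (Num.trunc x)).
Proof.
move=> a0 x0; rewrite -size_filter; apply: card_fset_set_seq.
  by rewrite filter_uniq ?iota_uniq.
move=> n; rewrite mem_filter mem_iota add1n ltnS truncn_ge_nat //=.
split=> [[/(RsetE _ _ a0)/and3P[-> -> ->] ->]|] //.
by move=> /and3P[/andP[p0 sm] n0 ->]; split=> //; apply/(RsetE _ _ a0);
  rewrite n0 p0.
Qed.

(** The map n |-> d n + r sends the n counted by N injectively to m counted by
    G; an m that is missed has the form d t + r with t <= 0, so m <= r. *)
Lemma count_progression_bounds (P : pred nat) d r (X y : nat) :
    0 < d -> Posz y = progression d r X ->
  let N := count (fun n : nat => (0 < progression d r n)%R &&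
                    P `|progression d r n|) (iota 1 X) in
  let G := count (fun m => P m && residue_class d r m) (iota 1 y) in
  N <= G /\ G <= N + `|r|.
Proof.
move=> d0 yE N G; rewrite {}/N {}/G -!size_filter.
set L1 := [seq _ <- _ | _]; set L2 := [seq _ <- iota 1 y | _].
have d0' : (0 < Posz d)%R by [].
have mono (t u : int) : (progression d r t <= progression d r u)%R = (t <= u)%R.
  by rewrite /progression lerD2r ler_pM2l.
rewrite -(size_map (fun n : nat => `|progression d r n|)); split.
  apply: uniq_leq_size.
    rewrite map_inj_in_uniq ?filter_uniq ?iota_uniq // => m n.
    rewrite !mem_filter => /andP[/andP[m0 _] _] /andP[/andP[n0 _] _].
    move=> /(congr1 Posz).
    by rewrite !gtz0_abs // => /(progression_inj d0)[].
  move=> m /mapP[n]; rewrite !mem_filter !mem_iota !add1n !ltnS =>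
    /and3P[/andP[p0 Pn] n0 nX] ->.
  rewrite Pn absz_gt0 gt_eqF // -lez_nat gtz0_abs // yE mono lez_nat nX !andbT.
  by apply/residue_classP; exists n; rewrite gtz0_abs.
rewrite -[X in _ + X](size_iota 1 `|r|) -size_cat; apply: uniq_leq_size.
  by rewrite filter_uniq ?iota_uniq.
move=> m; rewrite !mem_filter mem_cat !mem_iota !add1n !ltnS.
move=> /and3P[/andP[Pm /residue_classP[t mE]] m0 my]; apply/orP.
have [t0|t0] := lerP t 0; [right|left].
  rewrite m0 -lez_nat mE (le_trans (_ : _ <= r)%R) //; last exact: lez_abs.
  by rewrite /progression gerDr pmulr_rle0.
apply/mapP; exists `|t|; last by rewrite gtz0_abs // -mE.
rewrite mem_filter mem_iota add1n ltnS absz_gt0 gt_eqF // gtz0_abs // -mE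
  absz_nat Pm ltz_nat m0 /=.
by rewrite -lez_nat gtz0_abs // -mono -yE -mE lez_nat.
Qed.

Local Close Scope nat_scope.
Local Open Scope ring_scope.

(** * Lattice points in a simplex *)

(** Together with the next lemma, the mean value inequality for T^(n+1): it
    replaces the comparison of sums with integrals. *)
Lemma exprS_le_tangent (R : realFieldType) (x y : R) n : 0 <= y -> y <= x ->
  x ^+ n.+1 <= y ^+ n.+1 + n.+1%:R * (x - y) * x ^+ n.
Proof.
move=> y0 yx; have x0 := le_trans y0 yx; elim: n => [|n IH].
  by rewrite !expr1 expr0; lra.
have yxn : y ^+ n.+1 <= x ^+ n.+1 by apply: lerXn2r.
have H1 : x * x ^+ n.+1 <= x * (y ^+ n.+1 + n.+1%:R * (x - y) * x ^+ n).
  exact: ler_wpM2l.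
have H2 : (x - y) * y ^+ n.+1 <= (x - y) * x ^+ n.+1 by apply: ler_wpM2l;
  rewrite // subr_ge0.
rewrite (exprS x n.+1) (le_trans H1) //.
rewrite -subr_ge0 in H2; rewrite -subr_ge0 (le_trans H2) // le_eqVlt;
  apply/orP; left; apply/eqP.
rewrite -(natr1 n.+1) !exprS; ring.
Qed.

Lemma exprS_ge_tangent (R : realFieldType) (x y : R) n : 0 <= y -> y <= x ->
  y ^+ n.+1 + n.+1%:R * (x - y) * y ^+ n <= x ^+ n.+1.
Proof.
move=> y0 yx; have x0 := le_trans y0 yx; elim: n => [|n IH].
  by rewrite !expr1 expr0; lra.
have yxn : y ^+ n.+1 <= x ^+ n.+1 by apply: lerXn2r.
have H1 : y * (y ^+ n.+1 + n.+1%:R * (x - y) * y ^+ n) <= y * x ^+ n.+1.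
  exact: ler_wpM2l.
have H2 : (x - y) * y ^+ n.+1 <= (x - y) * x ^+ n.+1 by apply: ler_wpM2l;
  rewrite // subr_ge0.
have xE : y * x ^+ n.+1 + (x - y) * x ^+ n.+1 = x ^+ n.+2.
  by rewrite (exprS x n.+1); ring.
have := lerD H1 H2; rewrite xE; apply: le_trans.
rewrite le_eqVlt; apply/orP; left; apply/eqP.
rewrite -(natr1 n.+1) !exprS; ring.
Qed.

(** The side of the simplex in the direction of q is ln z divided by this
    weight. *)
Definition weight (R : realType) (e : nat -> nat) (q : nat) : R :=
  ln (q ^ e q)%:R.

Lemma weight_gt0 (R : realType) e q : prime q -> (0 < e q)%N ->
  0 < weight R e q.
Proof.
move=> pq e0; apply: ln_gt0; rewrite ltr1n -(exp1n (e q)).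
by rewrite ltn_exp2r // prime_gt1.
Qed.

(** The volume of the simplex as a lower bound. The bound is stated at [z.+1],
    which makes it survive the floor in the recursion:
    (z %/ P).+1 >= z.+1 / P for P = q ^ e q. *)
Lemma count_multiple_exponents_ge (R : realType) qs e z :
    all prime qs -> uniq qs -> {in qs, forall q, (0 < e q)%N} -> (0 < z)%N ->
  ln (z.+1%:R : R) ^+ size qs <=
  (count_multiple_exponents qs e z)%:R *
    ((size qs)`!%:R * \prod_(q <- qs) weight R e q).
Proof.
elim: qs z => [|q qs IH] z; first by move=> *;
  rewrite count_multiple_exponents_nil // big_nil !mulr1.
move=> pqs uqs e0; have /andP[pq pqs'] := pqs; have /andP[qnin uqs'] := uqs.
have e0' : {in qs, forall q, (0 < e q)%N} by move=> p pin; apply: e0;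
  rewrite inE pin orbT.
have eq0 : (0 < e q)%N by apply: e0; rewrite inE eqxx.
have {}IH z := IH z pqs' uqs' e0'.
set P := (q ^ e q)%N.
have P1 : (1 < P)%N by rewrite -(exp1n (e q)) ltn_exp2r ?prime_gt1.
elim/ltn_ind: z => z IHz z0.
rewrite count_multiple_exponents_cons // -/P big_cons factS natrM natrD.
set D := _`!%:R * _ in IH; set w := weight R e q.
have w0 : 0 < w by exact: weight_gt0.
set T := ln z.+1%:R.
have T0 : 0 <= T by apply: ln_ge0; rewrite ler1n.
rewrite (_ : _ * _`!%:R * _ = (size qs).+1%:R * w * D); last by rewrite /D;
  ring.
rewrite mulrDl /=; set s := size qs.
have HT : s.+1%:R * w * T ^+ s <=
  (count_multiple_exponents qs e z)%:R * (s.+1%:R * w * D).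
  by rewrite (mulrCA _ _ D) ler_wpM2l ?mulr_ge0 ?(ltW w0) // IH.
have [zP|Pz] := ltnP z P.
  rewrite (divn_small zP) mul0r addr0 (le_trans _ HT) //.
  rewrite exprS ler_wpM2r ?exprn_ge0 //.
  have Tw : T <= w by rewrite ler_ln ?posrE ?ltr0n ?ler_nat // ltnW.
  by rewrite (le_trans Tw) // ler_peMl ?(ltW w0) // ler1n.
set z' := (z %/ P)%N; have z'0 : (0 < z')%N by rewrite divn_gt0 // ltnW.
have zz' : (z' < z)%N by rewrite ltn_Pdiv.
have H2 := IHz _ zz' z'0.
rewrite (_ : _`!%:R * _ = s.+1%:R * w * D) in H2; last first.
  by rewrite big_cons /= factS natrM /D -/w; ring.
have HTw : T - w <= ln z'.+1%:R.
  rewrite lerBlDr /w /weight -lnM ?posrE ?ltr0n ?(ltnW P1) //.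
  by rewrite ler_ln ?posrE -?natrM ?ltr0n ?muln_gt0 ?(ltnW P1) // ler_nat
    ltn_ceil // ltnW.
have wT : 0 <= T - w.
  by rewrite subr_ge0 ler_ln ?posrE ?ltr0n ?ler_nat // ?(ltnW P1) // ltnW.
have H3 : (T - w) ^+ s.+1 <=
  (count_multiple_exponents (q :: qs) e z')%:R * (s.+1%:R * w * D).
  by apply: le_trans H2; apply: lerXn2r; rewrite // nnegrE ?(le_trans wT).
have H4 := @exprS_le_tangent _ T (T - w) s wT.
rewrite (le_trans (H4 _)) ?gerBl ?(ltW w0) // addrC lerD //.
by rewrite opprB addrC subrK.
Qed.

(** The unit cubes based at the lattice points lie in the simplex enlarged by
    the sum of the weights; the induction proves this bound through the
    recursion, where the enlargement by the weight of q absorbs the term with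
    l_1 = 0. *)
Lemma count_multiple_exponents_le (R : realType) qs e z :
    all prime qs -> uniq qs -> {in qs, forall q, (0 < e q)%N} -> (0 < z)%N ->
  (count_multiple_exponents qs e z)%:R *
    ((size qs)`!%:R * \prod_(q <- qs) weight R e q) <=
  (ln (z%:R : R) + \sum_(q <- qs) weight R e q) ^+ size qs.
Proof.
elim: qs z => [|q qs IH] z; first by move=> *;
  rewrite count_multiple_exponents_nil // big_nil !mulr1.
move=> pqs uqs e0; have /andP[pq pqs'] := pqs; have /andP[qnin uqs'] := uqs.
have e0' : {in qs, forall q, (0 < e q)%N} by move=> p pin; apply: e0;
  rewrite inE pin orbT.
have eq0 : (0 < e q)%N by apply: e0; rewrite inE eqxx.
have {}IH z := IH z pqs' uqs' e0'.
set P := (q ^ e q)%N.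
have P1 : (1 < P)%N by rewrite -(exp1n (e q)) ltn_exp2r ?prime_gt1.
elim/ltn_ind: z => z IHz z0.
rewrite count_multiple_exponents_cons // -/P !big_cons factS natrM natrD.
set D := _`!%:R * _ in IH; set w := weight R e q.
set S := \sum_(_ <- _) _ in IH *.
have w0 : 0 < w by exact: weight_gt0.
have S0 : 0 <= S.
  by rewrite /S big_seq sumr_ge0 // => p pin;
    rewrite ltW // weight_gt0 ?e0' // (allP pqs').
set T := ln z%:R.
have T0 : 0 <= T by apply: ln_ge0; rewrite ler1n.
rewrite (_ : _ * _`!%:R * _ = (size qs).+1%:R * w * D); last by rewrite /D;
  ring.
rewrite mulrDl /=; set s := size qs.
have HT : (count_multiple_exponents qs e z)%:R * (s.+1%:R * w * D) <=
  s.+1%:R * w * (T + S) ^+ s.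
  by rewrite (mulrCA _ _ D) ler_wpM2l ?mulr_ge0 ?(ltW w0) // IH.
have H4 := @exprS_ge_tangent _ (T + (w + S)) (T + S) s (addr_ge0 T0 S0).
rewrite (le_trans _ (H4 _)) ?lerD2l ?lerDr ?(ltW w0) //.
rewrite addrC lerD //; last by rewrite (_ : T + (w + S) - (T + S) = w) //; ring.
have [zP|Pz] := ltnP z P.
  by rewrite (divn_small zP) mul0r exprn_ge0 // addr_ge0.
set z' := (z %/ P)%N; have z'0 : (0 < z')%N by rewrite divn_gt0 // ltnW.
have zz' : (z' < z)%N by rewrite ltn_Pdiv.
have H2 := IHz _ zz' z'0.
rewrite (_ : _`!%:R * _ = s.+1%:R * w * D) in H2; last first.
  by rewrite big_cons /= factS natrM /D -/w; ring.
apply: (le_trans H2); rewrite big_cons addrA; apply: lerXn2r.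
- rewrite nnegrE !addr_ge0 ?(ltW w0) // ln_ge0 // ler1n //.
- by rewrite nnegrE addr_ge0.
rewrite lerD2r -lnM ?posrE ?ltr0n ?(ltnW P1) //.
by rewrite ler_ln ?posrE -?natrM ?ltr0n ?muln_gt0 ?z'0 ?(ltnW P1) // ler_nat
  leq_trunc_div.
Qed.

(** * Asymptotics *)

(** Both bounds are s-th powers of T + O(1), which the tangent inequality
    compares with T^s. The slack c lets T be the logarithm of a quantity that
    is comparable with z, uniformly in z. *)
Lemma count_multiple_exponents_asymptotics (R : realType) qs e (c : R) :
    all prime qs -> uniq qs -> {in qs, forall q, (0 < e q)%N} ->
    (0 < size qs)%N -> 0 <= c ->
  exists C : R, 0 <= C /\ forall z (T : R), (0 < z)%N -> 1 <= T ->
    T - c <= ln z.+1%:R -> ln z%:R <= T + c ->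
  `|(count_multiple_exponents qs e z)%:R
     - T ^+ size qs / ((size qs)`!%:R * \prod_(q <- qs) weight R e q)|
  <= C * T ^+ (size qs).-1.
Proof.
move=> pqs uqs e0 s0 c0.
have lower z := @count_multiple_exponents_ge R qs e z pqs uqs e0.
have upper z := @count_multiple_exponents_le R qs e z pqs uqs e0.
have w0 q : q \in qs -> 0 < weight R e q.
  by move=> qqs; rewrite weight_gt0 ?e0 // (allP pqs).
set D := _`!%:R * _ in lower upper *.
have D0 : 0 < D.
  rewrite mulr_gt0 ?ltr0n ?fact_gt0 // big_seq.
  by apply: prodr_gt0.
set S := \sum_(_ <- _) _ in upper.
have S0 : 0 <= S by rewrite /S big_seq sumr_ge0 // => q /w0/ltW.
case sE : (size qs) s0 lower upper => [//|s] _ lower upper /=.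
pose c1 := c + S; have c10 : 0 <= c1 by rewrite addr_ge0.
(* The factor (1 + c1)^s comes from T + c1 <= (1 + c1) T, valid as 1 <= T. *)
pose K := s.+1%:R * c1 * (1 + c1) ^+ s.
have K0 : 0 <= K by rewrite !mulr_ge0 // exprn_ge0 // addr_ge0.
exists (K / D); split; first by rewrite divr_ge0 // ltW.
move=> z T z0 T1 zlow zup; have T0 : 0 <= T by rewrite (le_trans _ T1).
rewrite -(ler_pM2r D0) -[X in _ * X <= _](gtr0_norm D0) -normrM.
rewrite mulrBl divfK ?gt_eqF //.
rewrite mulrAC divfK ?gt_eqF //.
have Ts0 : 0 <= T ^+ s by exact: exprn_ge0.
rewrite ler_norml lerBlDr lerBrDr; apply/andP; split.
  have cK : s.+1%:R * c * T ^+ s <= K * T ^+ s.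
    rewrite ler_wpM2r // -[leLHS]mulr1 ler_pM ?mulr_ge0 //.
      by rewrite ler_wpM2l // lerDl.
    by rewrite exprn_ege1 // lerDl.
  (* If T <= c, then T^s.+1 is already at most the error term. *)
  have [Tc|cT] := lerP T c.
    apply: (@le_trans _ _ 0); last by rewrite mulr_ge0 ?(ltW D0).
    rewrite addrC subr_le0; apply: le_trans cK.
    by rewrite exprS ler_wpM2r // (le_trans Tc) // ler_peMl // ler1n.
  have Tc0 : 0 <= T - c by rewrite subr_ge0 ltW.
  have H := @exprS_le_tangent _ T (T - c) s Tc0.
  apply: le_trans (lower z z0); rewrite addrC lerBlDr.
  apply: le_trans (H _) _; first by rewrite gerBl.
  rewrite opprB addrCA subrr addr0 lerD //.
  by apply: lerXn2r; rewrite // nnegrE ?(le_trans Tc0).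
have lnz0 : 0 <= ln z%:R :> R by rewrite ln_ge0 // ler1n.
apply: le_trans (upper z z0) _.
have H1 : (ln z%:R + S) ^+ s.+1 <= (T + c1) ^+ s.+1.
  apply: lerXn2r; rewrite ?nnegrE ?addr_ge0 // /c1 addrA lerD2r //.
apply: le_trans H1 _.
have H := @exprS_le_tangent _ (T + c1) T s T0.
apply: le_trans (H _) _; first by rewrite lerDl.
rewrite (_ : T + c1 - T = c1); last by ring.
rewrite addrC lerD2r /K -[leRHS]mulrA ler_wpM2l ?mulr_ge0 //.
rewrite -exprMn; apply: lerXn2r; rewrite ?nnegrE ?mulr_ge0 ?addr_ge0 //.
by rewrite mulrDl mul1r lerD2l ler_peMr.
Qed.

(** For d n + r with n the integer part of x, division by a bounded m keeps the
    result between two fixed positive multiples of x when x is large, so its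
    logarithm is ln x + O(1). *)
Lemma progression_quotient_log (R : realType) d r B : (0 < d)%N ->
  exists c : R, 0 <= c /\ \forall x \near +oo,
    let y := progression d r (Num.trunc x) in
    0 <= y /\ forall m, (0 < m <= B)%N ->
      [/\ (0 < `|y|%N %/ m)%N,
         ln x - c <= ln (`|y|%N %/ m).+1%:R &
         ln (`|y|%N %/ m)%:R <= ln x + c].
Proof.
move=> d0; set beta := `|r|%N.
have dpos : (0 < d + beta)%N by rewrite addn_gt0 d0.
have lnge0 n : (0 < n)%N -> 0 <= ln (n%:R : R) by move=> n0;
  rewrite ln_ge0 // ler1n.
(* x <= 2 (B+1) (z+1) and z <= (d + beta) x for the quotient z. *)
exists (ln (2 * B.+1)%:R + ln (d + beta)%:R); split.
  by rewrite addr_ge0 ?lnge0.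
near=> x.
have xbig : (2 * (beta + B + 2))%:R <= x by near: x; exact: nbhs_pinfty_ge.
have x0 : 0 < x by apply: lt_le_trans xbig; rewrite ltr0n; lia.
set X := Num.trunc x; set y := progression d r X.
have /andP[Xx xX] := truncn_itv (ltW x0); rewrite -/X in Xx xX.
have Xbig : (2 * (beta + B + 2) <= X)%N by rewrite truncn_ge_nat // ltW.
have y0 : 0 <= y by rewrite /y /progression; rewrite /beta in Xbig; nia.
split=> //; move: y0; set Y := `|y|%N => y0.
have YE : (Y : int) = d%:Z * X%:Z + r by rewrite /Y gez0_abs.
have XY : (X <= Y + beta)%N by rewrite /beta; nia.
have YX : (Y <= d * X + beta)%N by rewrite /beta; lia.
move=> m /andP[m0 mB]; set z := (Y %/ m)%N.
have z0 : (0 < z)%N by rewrite divn_gt0 //; lia.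
have Yz : (Y < z.+1 * m)%N by exact: ltn_ceil.
have zY : (z <= Y)%N by exact: leq_div.
have XzB : (X.+1 <= 2 * B.+1 * z.+1)%N by nia.
have zX : (z <= (d + beta) * X)%N by nia.
split=> //.
  have : ln x <= ln (2 * B.+1 * z.+1)%:R.
    by rewrite ler_ln ?posrE ?ltr0n // (le_trans (ltW xX)) // ler_nat.
  rewrite natrM lnM ?posrE ?ltr0n // => H.
  by have := lnge0 _ dpos; lra.
have : ln z%:R <= ln ((d + beta)%:R * x).
  rewrite ler_ln ?posrE ?ltr0n ?mulr_gt0 ?ltr0n //.
  by rewrite (@le_trans _ _ ((d + beta) * X)%:R) ?ler_nat // natrM ler_wpM2l.
rewrite lnM ?posrE ?ltr0n // => H.
by have := lnge0 (2 * B.+1)%N isT; lra.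
Unshelve. all: by end_near. Qed.

Lemma Rcount_asymptotics (R : realType) a b : (0 < a)%N ->
    let qs := residual_primes (qa a b) (gab a b) in
    (0 < size qs)%N ->
  exists C : R, \forall x \near +oo,
    `|(Rcount a b x)%:R - (rho0 a b)%:R
         / ((size qs)`!%:R * \prod_(q <- qs) weight R (order_at (qa a b)) q)
         * ln x ^+ size qs|
    <= C * `|ln x ^+ (size qs).-1|.
Proof.
move=> a0; have d0 := qa_gt0 b a0; set d := qa a b in d0 *; set r := qb a b.
move=> qs s0; pose e := order_at d.
have pqs : all prime qs by exact: residual_primes_prime.
have uqs : uniq qs by exact: residual_primes_uniq.
have e0 : {in qs, forall q, (0 < e q)%N} by exact: order_at_gt0.
rewrite rho0E // -/d -/r -/qs -/e.
set M0 := small_exponents_class qs e (residue_class d r).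
have [c [c0 Hc]] := progression_quotient_log R r (from_exponents qs e) d0.
have [C [C0 HC]] := count_multiple_exponents_asymptotics pqs uqs e0 s0 c0.
set D := _`!%:R * _ in HC *.
exists (`|r|%N%:R + (size M0)%:R * C); near=> x.
have T1 : 1 <= ln x.
  have ex : expR 1 <= x by near: x; exact: nbhs_pinfty_ge.
  by rewrite -ler_expR lnK // posrE (lt_le_trans _ ex) ?expR_gt0.
have x0 : 0 <= x by near: x; exact: nbhs_pinfty_ge.
have /= := near Hc x; move=> /(_ _)[]//.
set X := Num.trunc x; set y := progression d r X => y0 Hy.
have yE : (`|y|%N : int) = progression d r X by rewrite gez0_abs.
set T := ln x in T1 Hy *.
have T0 : 0 <= T by rewrite (le_trans _ T1).
rewrite RcountE // -/d -/r -/qs -/X.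
have [NG GN] := count_progression_bounds (smooth qs) d0 yE.
set N := count _ _ in NG GN *; set G := count _ _ in NG GN *.
have GE : G = \sum_(m0 <- M0) count_multiple_exponents qs e (`|y|%N %/ m0).
  apply: count_smooth_class => // m0 m1 fm1.
  by apply: residue_classM; apply: multiple_exponents_mod1 fm1 => //;
    exact: expn_order_at.
rewrite [X in _ <= _ * X]ger0_norm ?exprn_ge0 //.
have Ts1 : 1 <= T ^+ (size qs).-1 by exact: exprn_ege1.
have -> : N%:R - (size M0)%:R / D * T ^+ size qs =
    (N%:R - G%:R) + \sum_(m0 <- M0)
      ((count_multiple_exponents qs e (`|y|%N %/ m0))%:R
        - T ^+ size qs / D) :> R.
  rewrite sumrB -natr_sum -GE big_const_seq count_predT iter_addr_0.
  by rewrite addrA subrK mulrAC -mulrA mulr_natl.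
apply: le_trans (ler_normD _ _) _; rewrite mulrDl lerD //.
  apply: (@le_trans _ _ `|r|%N%:R); last by rewrite ler_peMr.
  rewrite distrC ger0_norm ?subr_ge0 ?ler_nat //.
  by rewrite lerBlDl -natrD ler_nat.
apply: le_trans (ler_norm_sum _ _ _) _.
rewrite -mulrA mulr_natl -(iter_addr_0 (size M0)) -(count_predT M0)
  -big_const_seq.
rewrite big_seq [leRHS]big_seq; apply: ler_sum => m0;
  rewrite mem_small_exponents_class // => /andP[rm0 _].
have /Hy[z0 z1 z2] : (0 < m0 <= from_exponents qs e)%N.
  by rewrite small_exponents_le // andbT; case/andP: rm0 => /smooth_gt0.
exact: HC.
Unshelve. all: by end_near. Qed.

(** * The primes q_i and the positivity of s and rho_0 *)

Lemma residual_primes_perm d g s (q : 'I_s -> nat) : (forall i, prime (q i)) ->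
  tau (d : nat) (int_rad (g : nat)) = (\prod_(i < s) q i)%N ->
  perm_eq (residual_primes d g) [seq q i | i <- enum 'I_s].
Proof.
move=> pq E; apply: perm_eq_primes.
- exact: residual_primes_prime.
- by apply/allP => p /mapP[i _ ->].
- by rewrite -tau_int_rad E big_map big_enum.
Qed.

(** With no residual prime, only d n + r = 1 is smooth. *)
Lemma infinite_Rset_residual_primes a b : (0 < a)%N ->
  infinite_set (Rset a b) ->
  (0 < size (residual_primes (qa a b) (gab a b)))%N.
Proof.
move=> a0 inf; have d0 := qa_gt0 b a0; rewrite lt0n; apply/negP => /nilP qs0;
  apply: inf.
apply: (sub_finite_set _ (finite_seq (iota 0 `|qb a b|.+2))) => n.
move=> /(RsetE _ _ a0); rewrite qs0 => /and3P[n0 m0 sm].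
have m1 : `|progression (qa a b) (qb a b) n|%N = 1%N.
  by apply: (smooth_eq (qs := [::])) => //.
suff : n \in iota 0 `|qb a b|.+2 by [].
rewrite mem_iota /=; move: m1; rewrite /progression; nia.
Qed.

(** If n is in R(a,b), the small part m0 of d n + r is in the class of r and
    hence comes from an element of R_0(a,b). *)
Lemma rho0_gt0 a b n : (0 < a)%N -> Rset a b n -> (0 < rho0 a b)%N.
Proof.
move=> a0 /(RsetE _ _ a0)/and3P[n0 m0 sm]; have d0 := qa_gt0 b a0.
have pqs := residual_primes_prime (qa a b) (gab a b).
have uqs := residual_primes_uniq (qa a b) (gab a b).
have [m1 [m2 [mE rm1 fm2]]] := smooth_decomposition pqs uqs 
  (@order_at_gt0 _ (gab a b) d0) sm.
rewrite rho0E //; set M0 := small_exponents_class _ _ _.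
suff : m1 \in M0 by case: M0.
rewrite mem_small_exponents_class // rm1 -(@residue_classM _ _ _ m2);
  last first.
  by apply: multiple_exponents_mod1 fm2 => //; exact: expn_order_at.
by rewrite -mE; apply/residue_classP; exists n; rewrite gtz0_abs.
Qed.

Theorem theorem33 (R : realType) (a : nat) (b : int) (ha : (0 < a)%N)
  (s : nat) (q : 'I_s -> nat)
  (hq : forall i, prime (q i))
  (hqprod : tau (qa a b) (int_rad (gab a b)) = (\prod_(i < s) q i)%N)
  (k : 'I_s -> nat) (hk : forall i, k i = ord (qa a b) (q i))
  (hrho : rho R a b = +oo%E) :
  [/\ (1 <= s)%N,
      (1 <= rho0 a b)%N &
      exists C : R, \forall x \near +oo,
        `|(Rcount a b x)%:R - (rho0 a b)%:R
             / (s`!%:R * \prod_(i < s) ln ((q i ^ k i)%:R : R)) * ln x ^+ s|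
        <= C * `|ln x ^+ s.-1| ].
Proof.
have inf : infinite_set (Rset a b).
  by move=> fin; move: hrho; rewrite /rho /counting; case: asboolP.
have perm_q := residual_primes_perm hq hqprod.
have size_q : size (residual_primes (qa a b) (gab a b)) = s.
  by rewrite (perm_size perm_q) size_map size_enum_ord.
have s0 := infinite_Rset_residual_primes ha inf.
have [n Rn] : exists n, Rset a b n.
  apply: contrapT => /forallNP N; apply: inf.
  by rewrite (_ : Rset a b = set0) // -subset0.
have weightE :
    \prod_(p <- residual_primes (qa a b) (gab a b)) weight R (order_at (qa a b)) p
    = \prod_(i < s) ln ((q i ^ k i)%:R : R).
  rewrite (perm_big _ perm_q) big_map big_enum.
  by apply: eq_bigr => i _; rewrite hk.
have := @Rcount_asymptotics R a b ha s0; rewrite weightE size_q => main.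
by split=> //; [rewrite -size_q | exact: rho0_gt0 Rn].
Qed.
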